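(* Let $C_n$ be the cycle graph of order $n\geq 3$. Then $N_{sp}(C_n)=4$ if $n\equiv 0\pmod 4$; $N_{sp}(C_n)=2n$ if $n\equiv 1\pmod 4$; $N_{sp}(C_n)=\frac{5n^2-10n}{8}$ if $n\equiv 2\pmod 4$; and $N_{sp}(C_n)=n$ if $n\equiv 3\pmod 4$.
   Context: All graphs are finite, simple, undirected. For $S\subseteq V(G)$, $\overline{S}=V(G)\setminus S$ and $N(v)$ denotes the open neighbourhood of $v$. A set $S$ is a super dominating set of $G$ if every vertex of $\overline{S}$ has a neighbour in $S$ and for every $u\in\overline{S}$ there is $v\in S$ with $N(v)\cap\overline{S}=\{u\}$. The super domination number $\gamma_{sp}(G)$ is the minimum cardinality of a super dominating set of $G$. $N_{sp}(G)$ denotes the number of super dominating sets of $G$ of cardinality $\gamma_{sp}(G)$ (as vertex subsets of the labelled graph). $C_n$ is the cycle on $n$ vertices. *)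

(* Defs.v *)
From mathcomp Require Import all_boot.

Set Implicit Arguments.
Unset Strict Implicit.
Unset Printing Implicit Defensive.

Record sgraph := SGraph {
  vertex :> finType;
  adj : rel vertex;
  adj_sym : symmetric adj;
  adj_irr : irreflexive adj
}.

Definition nbhd (G : sgraph) (v : G) : {set G} := [set u | adj v u].

Definition dominating (G : sgraph) (S : {set G}) : bool :=
  [forall u in ~: S, exists v in S, adj u v].

Definition super_dominating (G : sgraph) (S : {set G}) : bool :=
  dominating S &&
  [forall u in ~: S, exists v in S, nbhd v :&: ~: S == [set u]].

(* [set: G] is the witness required by [arg min]; see super_dominatingT. *)
Definition gamma_sp (G : sgraph) : nat :=
  #|[arg min_(S < [set: G] | super_dominating S) #|S| ]|.

Definition N_sp (G : sgraph) : nat :=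
  #|[set S : {set G} | super_dominating S && (#|S| == gamma_sp G)]|.

Lemma super_dominatingT (G : sgraph) : super_dominating [set: G].
Proof.
by apply/andP; split; apply/forall_inP => u; rewrite setCT inE.
Qed.

Lemma gamma_sp_min (G : sgraph) (S : {set G}) :
  super_dominating S -> gamma_sp G <= #|S|.
Proof.
rewrite /gamma_sp; case: arg_minnP => [|T _ minT]; last exact: minT.
exact: super_dominatingT.
Qed.

Lemma gamma_sp_witness (G : sgraph) :
  exists2 S : {set G}, super_dominating S & #|S| = gamma_sp G.
Proof.
rewrite /gamma_sp; case: arg_minnP => [|T sdT _]; last by exists T.
exact: super_dominatingT.
Qed.

(* The condition i != j only matters for n = 1, where it removes the loop. *)
Definition cycle_adj (n : nat) : rel 'I_n := fun i j =>
  (i != j) && ((j == i.+1 %[mod n]) || (i == j.+1 %[mod n])).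

Lemma cycle_adj_sym (n : nat) : symmetric (@cycle_adj n).
Proof. by move=> i j; rewrite /cycle_adj eq_sym orbC. Qed.

Lemma cycle_adj_irr (n : nat) : irreflexive (@cycle_adj n).
Proof. by move=> i; rewrite /cycle_adj eqxx. Qed.

Definition cycle_graph (n : nat) : sgraph :=
  SGraph (@cycle_adj_sym n) (@cycle_adj_irr n).

(* Main.v *)
From HB Require Import structures.
Require Import Defs.
From mathcomp Require Import all_boot all_order all_algebra zify ring.
Import GRing.Theory.

(** On a cycle, S is super dominating iff every vertex outside S has, on one of
its two sides, two consecutive vertices of S.  Read cyclically, the indicator
word of S is then a closed walk of a deterministic automaton whose simple cycles
all pass through the same state and spell 0011, 1, 011 and 01011.  The excess of
ones over zeros is 0 for the first of these words and 1 for the other three, so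
the numbers T(n, c) of closed walks of length n and excess c satisfy
T(n, c) = T(n-4, c) + T(n-1, c-1) + T(n-3, c-1) + T(n-5, c-1).  Minimum super
dominating sets have excess 0, 1, 2, 1 for n = 0, 1, 2, 3 mod 4. *)

(** * The automaton and its cost function *)

(* The letter [true] means membership in S.  [Sat]: 11 has just been read; [Z]: a zero
   preceded by 11; [Y]: a zero not preceded by 11, hence to be followed by 11; [ZI], [YI]:
   one letter 1 after [Z], [Y]. *)
Inductive state := Sat | Z | ZI | Y | YI | Dead.

Definition step (s : state) (b : bool) : state :=
  match s, b with
  | Sat, true | ZI, true | YI, true => Sat
  | Sat, false => Z
  | Z, true => ZI
  | Z, false | ZI, false => Y
  | Y, true => YI
  | _, _ => Dead
  end.

Lemma state_eq_dec : comparable state.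
Proof. by move=> s t; rewrite /decidable; decide equality. Defined.

HB.instance Definition _ := hasDecEq.Build state (compareP state_eq_dec).

Definition live : seq state := [:: Sat; Z; ZI; Y; YI].

Lemma mem_live s : (s \in live) = (s != Dead).
Proof. by case: s. Qed.

(* [surplus] differs from the letter's contribution to (ones - zeros) by the variation of the
   potential [debt]; this makes all costs natural numbers. *)
Definition surplus (s : state) (b : bool) : nat :=
  match s, b with
  | Sat, true | ZI, _ => 1
  | _, _ => 0
  end.

Definition run (s : state) (w : seq bool) : state := foldl step s w.

Fixpoint cost (s : state) (w : seq bool) : nat :=
  if w is b :: w' then surplus s b + cost (step s b) w' else 0.

Definition debt (s : state) : nat :=
  match s with Z | YI => 1 | Y => 2 | _ => 0 end.

Lemma run_Dead w : run Dead w = Dead.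
Proof. by elim: w => //= b w IH; case: b. Qed.

Lemma run_balance s w : run s w != Dead ->
  count id w + debt (run s w) = count negb w + cost s w + debt s.
Proof.
elim: w s => [|b w IH] s /=; first by rewrite !add0n.
by case: s; case: b => /=; rewrite ?run_Dead ?eqxx // => /IH /=; lia.
Qed.

(** Around a closed walk the debts cancel, so the cost is exactly ones minus zeros. Prescribing the
    size of a set thus amounts to prescribing a cost. *)
Lemma closed_balance s w : s != Dead -> run s w = s ->
  2 * count id w = size w + cost s w.
Proof.
move=> sD sC; have := run_balance s w; rewrite sC => /(_ sD).
by have : count id w + count negb w = size w := count_predC id w; lia.
Qed.

(** * Counting walks by length and cost *)

(** Recursion on the first letter makes these numbers computable, which provides the base cases of
    the inductions on length. *)
Fixpoint walks (t : state) (n : nat) (s : state) (c : nat) : nat :=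
  if n is n'.+1 then
    let go b := if surplus s b <= c then walks t n' (step s b) (c - surplus s b)
                else 0 in
    go true + go false
  else (s == t) && (c == 0).

Lemma card_tupleS n (P : pred (seq bool)) :
  #|[set w : n.+1.-tuple bool | P w]| =
  #|[set w : n.-tuple bool | P (true :: w)]|
  + #|[set w : n.-tuple bool | P (false :: w)]|.
Proof.
rewrite -!sum1dep_card.
rewrite (reindex (fun p : bool * n.-tuple bool => cons_tuple p.1 p.2)) /=; last first.
  exists (fun t : n.+1.-tuple bool => (thead t, behead_tuple t)).
    by move=> [b t] _ /=; congr pair; apply: val_inj.
  by move=> t _; rewrite /= [RHS]tuple_eta; apply: val_inj.
rewrite -(pair_big_dep xpredT (fun b (t : n.-tuple bool) => P (b :: t))
  (fun _ _ => 1)) /=.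
by rewrite big_bool.
Qed.

Lemma card_walks t n s c :
  #|[set w : n.-tuple bool | (run s w == t) && (cost s w == c)]| = walks t n s c.
Proof.
elim: n s c => [|n IH] s c /=.
  rewrite -sum1dep_card big_mkcond (eq_bigr (fun=> (s == t) && (c == 0) : nat)).
    by rewrite sum_nat_const card_tuple mul1n.
  by move=> w _; rewrite [w]tuple0 /= [0 == c]eq_sym; case: ifP.
rewrite (card_tupleS n (fun w => (run s w == t) && (cost s w == c))) /=.
have E b : #|[set w : n.-tuple bool | (run (step s b) w == t)
      && (surplus s b + cost (step s b) w == c)]| =
    if surplus s b <= c then walks t n (step s b) (c - surplus s b) else 0.
  case: leqP => h.
    rewrite -IH; apply: eq_card => w; rewrite !inE.
    by congr andb; lia.
  apply/eqP; rewrite cards_eq0; apply/eqP/setP => w; rewrite !inE.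
  by apply/negP => /andP[_ /eqP]; lia.
by rewrite -!E.
Qed.

Lemma walks_Dead t n c : t != Dead -> walks t n Dead c = 0.
Proof.
move=> tD; elim: n c => [|n IH] c /=; first by rewrite eq_sym (negPf tD).
by rewrite !IH.
Qed.

Lemma walks_rec t n c : t != Dead ->
  [/\ walks t n.+1 Sat c.+1 = walks t n Sat c + walks t n Z c.+1,
      walks t n.+1 ZI c.+1 = walks t n Sat c + walks t n Y c
    & [/\ walks t n.+1 Sat 0 = walks t n Z 0,
      walks t n.+1 ZI 0 = 0,
      walks t n.+1 Z c = walks t n ZI c + walks t n Y c,
      walks t n.+1 Y c = walks t n YI c &
      walks t n.+1 YI c = walks t n Sat c]].
Proof.
by move=> tD; split; [..|split] => /=; rewrite ?subn0 ?subn1 ?walks_Dead ?addn0.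
Qed.

(** All simple cycles of the live states pass through [Sat], so their transfer matrix M, with y
    marking surplus, has det(I - xM) = 1 - x^4 - y(x + x^3 + x^5). By Cayley-Hamilton every entry of
    its powers obeys the corresponding recurrence. The offset 8 leaves even the shortest term some
    steps to unfold, after which the identity is linear. *)
Lemma walks_first_return s t n : t != Dead -> s \in live ->
  walks t (n + 8) s 0 = walks t (n + 4) s 0
  /\ forall c, walks t (n + 8) s c.+1 =
       walks t (n + 4) s c.+1 + walks t (n + 7) s c + walks t (n + 5) s c
       + walks t (n + 3) s c.
Proof.
move=> tD; rewrite !addnS addn0 => sl.
have R m c := walks_rec t m c tD.
have SatS m c : walks t m.+1 Sat c.+1 = walks t m Sat c + walks t m Z c.+1 by case: (R m c).
have ZIS m c : walks t m.+1 ZI c.+1 = walks t m Sat c + walks t m Y c by case: (R m c).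
have Sat0 m : walks t m.+1 Sat 0 = walks t m Z 0 by case: (R m 0) => _ _ [].
have ZI0 m : walks t m.+1 ZI 0 = 0 by case: (R m 0) => _ _ [].
have ZS m c : walks t m.+1 Z c = walks t m ZI c + walks t m Y c by case: (R m c) => _ _ [].
have YS m c : walks t m.+1 Y c = walks t m YI c by case: (R m c) => _ _ [].
have YIS m c : walks t m.+1 YI c = walks t m Sat c by case: (R m c) => _ _ [].
by split=> [|[|c]]; move: sl; rewrite !inE => /or4P[|||/orP[]] /eqP ->;
  rewrite ?(SatS, ZIS, Sat0, ZI0, ZS, YS, YIS); lia.
Qed.

(** The coefficient of y^c in the trace of M^n, where M is the transfer matrix of the live
    states. *)
Definition closed_walks n c := \sum_(s <- live) walks s n s c.

Lemma closed_walks_rec0 n : closed_walks (n + 8) 0 = closed_walks (n + 4) 0.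
Proof.
apply: eq_big_seq => s sl; move: (sl); rewrite mem_live => sD.
by have [] := walks_first_return s s n sD sl.
Qed.

Lemma closed_walks_recS n c :
  closed_walks (n + 8) c.+1 = closed_walks (n + 4) c.+1 + closed_walks (n + 7) c
    + closed_walks (n + 5) c + closed_walks (n + 3) c.
Proof.
rewrite /closed_walks -!big_split; apply: eq_big_seq => s sl.
move: (sl); rewrite mem_live => sD.
by have [_] := walks_first_return s s n sD sl; apply.
Qed.

Lemma closed_walks0 n : 0 < n -> closed_walks n 0 = if 4 %| n then 4 else 0.
Proof.
elim/ltn_ind: n => n IH n0.
case: (ltnP n 8) => [n8|n8].
  (* The recurrence starts at length 8; shorter lengths are computed. *)
  move: n n0 n8 {IH}; do 8?[case=> //]; rewrite /closed_walks unlock => *; by vm_compute.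
rewrite -(subnK n8) closed_walks_rec0 IH; [|lia..].
by rewrite !dvdn_addl.
Qed.

Lemma closed_walks1_1 m : closed_walks (4 * m + 5) 1 = 2 * (4 * m + 5).
Proof.
elim: m => [|m IH]; first by rewrite /closed_walks unlock; vm_compute.
have := closed_walks_recS (4 * m + 1) 0.
rewrite (_ : 4 * m + 1 + 8 = 4 * m.+1 + 5); last lia.
rewrite (_ : 4 * m + 1 + 4 = 4 * m + 5); last lia.
rewrite (_ : 4 * m + 1 + 7 = 4 * m.+1 + 4); last lia.
rewrite (_ : 4 * m + 1 + 5 = 4 * m.+1 + 2); last lia.
rewrite (_ : 4 * m + 1 + 3 = 4 * m + 4); last lia.
rewrite IH !closed_walks0; [|lia..]; do !case: ifP; lia.
Qed.

Lemma closed_walks1_3 m : closed_walks (4 * m + 3) 1 = 4 * m + 3.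
Proof.
(* Lengths 3 and 7 both lie below the range of the recurrence. *)
elim: m => [|[|m] IH]; [by rewrite /closed_walks unlock; vm_compute..|].
have := closed_walks_recS (4 * m + 3) 0.
rewrite (_ : 4 * m + 3 + 8 = 4 * m.+2 + 3); last lia.
rewrite (_ : 4 * m + 3 + 4 = 4 * m.+1 + 3); last lia.
rewrite (_ : 4 * m + 3 + 7 = 4 * m.+2 + 2); last lia.
rewrite (_ : 4 * m + 3 + 5 = 4 * m.+1 + 4); last lia.
rewrite (_ : 4 * m + 3 + 3 = 4 * m.+1 + 2); last lia.
rewrite IH !closed_walks0; [|lia..]; do !case: ifP; lia.
Qed.

Lemma closed_walks2_2 m :
  closed_walks (4 * m + 6) 2 = 5 * (m.+1 * (2 * m + 3)).
Proof.
elim: m => [|m IH]; first by rewrite /closed_walks unlock; vm_compute.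
have := closed_walks_recS (4 * m + 2) 1.
rewrite (_ : 4 * m + 2 + 8 = 4 * m.+1 + 6); last lia.
rewrite (_ : 4 * m + 2 + 4 = 4 * m + 6); last lia.
rewrite (_ : 4 * m + 2 + 7 = 4 * m.+1 + 5); last lia.
rewrite (_ : 4 * m + 2 + 5 = 4 * m.+1 + 3); last lia.
rewrite (_ : 4 * m + 2 + 3 = 4 * m + 5); last lia.
rewrite IH !closed_walks1_1 closed_walks1_3; lia.
Qed.

(** * Five-letter windows and closed runs on periodic words *)

Definition supported (a b c d e : bool) : bool := [|| c, a && b | d && e].

Definition last4 (a b c d : bool) : state :=
  if d then if c then Sat else if a && b then ZI else YI
  else if b && c then Z else Y.

(** The automaton synchronizes: a run that survives four letters has forgotten its starting
    state. *)
Lemma run_last4 s a b c d :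
  run s [:: a; b; c; d] != Dead -> run s [:: a; b; c; d] = last4 a b c d.
Proof. by case: s; case: a; case: b; case: c; case: d. Qed.

Lemma run_supported s a b c d e :
  run s [:: a; b; c; d; e] != Dead -> supported a b c d e.
Proof. by case: s; case: a; case: b; case: c; case: d; case: e. Qed.

(** Only the letter 0 read in [Y] or [YI] is fatal to a live state. In [YI] the support of [c]
    forces [e] to be 1; in [Y] the support of [d] does, which is why the second window is needed. *)
Lemma step_last4 a b c d e f :
  supported a b c d e -> supported b c d e f ->
  step (last4 a b c d) e = last4 b c d e.
Proof. by case: a; case: b; case: c; case: d; case: e; case: f. Qed.

Section PeriodicWords.

Variables (x : nat -> bool) (n : nat).
Hypotheses (n_gt0 : 0 < n) (x_periodic : forall i, x (i + n) = x i).

Definition orbit_at s i := run s (mkseq x i).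

Lemma orbit_atS s i : orbit_at s i.+1 = step (orbit_at s i) (x i).
Proof. by rewrite /orbit_at /run mkseqS foldl_rcons. Qed.

Lemma periodicM i k : x (i + k * n) = x i.
Proof. by elim: k => [|k IH]; rewrite ?addn0 // mulSn addnCA addnC x_periodic. Qed.

Section ClosedWalk.

Variables (s : state).
Hypotheses (s_live : s != Dead) (s_closed : orbit_at s n = s).

Lemma orbit_at_periodicM i k : orbit_at s (i + k * n) = orbit_at s i.
Proof.
elim: k => [|k <-]; first by rewrite addn0.
rewrite mulSn addnCA; elim: (i + _) => [|j IH]; first by rewrite addn0.
by rewrite addnS !orbit_atS IH addnC x_periodic.
Qed.

Lemma orbit_at_live i : orbit_at s i != Dead.
Proof.
apply/negP => /eqP iD.
have D j : orbit_at s (i + j) = Dead.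
  by elim: j => [|j IH]; rewrite ?addn0 // addnS orbit_atS IH; case: (x _).
(* At time [i * n], which is at least [i], the run is back at [s], although it is dead from time [i]
   on. *)
move: s_live; rewrite -[s in s != _]/(orbit_at s 0) -(orbit_at_periodicM 0 i) add0n.
have /subnKC <- : i <= i * n by rewrite leq_pmulr.
by rewrite D.
Qed.

Lemma orbit_at_last4 i :
  orbit_at s i.+4 = last4 (x i) (x i.+1) (x i.+2) (x i.+3).
Proof.
have := orbit_at_live i.+4; rewrite !orbit_atS; exact: run_last4.
Qed.

Lemma closed_supported i :
  supported (x i) (x i.+1) (x i.+2) (x i.+3) (x i.+4).
Proof.
have := orbit_at_live (i + 5); rewrite !addnS addn0 !orbit_atS; exact: run_supported.
Qed.

(* The state of a closed walk is determined by the word, so closed walks count words. *)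
Lemma closed_last4 (m := 4 * n - 4) :
  s = last4 (x m) (x m.+1) (x m.+2) (x m.+3).
Proof.
rewrite -orbit_at_last4 -[s in LHS]/(orbit_at s 0) -(orbit_at_periodicM 0 4).
by congr orbit_at; rewrite /m; lia.
Qed.

End ClosedWalk.

(** The start is the state dictated by the four letters that cyclically precede position 0.
    Supported windows keep the run equal to the state read off its last four letters, and
    periodicity closes it. *)
Lemma supported_closed :
  (forall i, supported (x i) (x i.+1) (x i.+2) (x i.+3) (x i.+4)) ->
  exists2 s, s \in live & orbit_at s n = s.
Proof.
move=> ok; pose tau i := last4 (x i) (x i.+1) (x i.+2) (x i.+3).
have tauS i : step (tau i) (x i.+4) = tau i.+1 by exact: step_last4 (ok i) (ok i.+1).
(* [m + 4] is a whole number of periods; four of them ensure four preceding letters even when [n] is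
   below 4. *)
pose m := 4 * n - 4.
have E i : orbit_at (tau m) i = tau (m + i).
  elim: i => [|i IH]; first by rewrite addn0.
  rewrite orbit_atS IH addnS -tauS -(periodicM i 4).
  by congr (step _ (x _)); rewrite /m; lia.
exists (tau m).
  by rewrite /tau /last4; do !case: ifP.
by rewrite E /tau -!addSn !x_periodic.
Qed.

End PeriodicWords.

(** * Super dominating sets of a cycle as closed walks *)

Section Cycle.

Variable n : nat.
Local Notation G := (cycle_graph n.+3).
Implicit Type S : {set G}.

Definition vtx (i : nat) : G := inZp i.

Lemma vtx_periodic i : vtx (i + n.+3) = vtx i.
Proof. by apply: val_inj; rewrite /= modnDr. Qed.

Lemma vtx_ord (u : G) : vtx u = u.
Proof. by apply: val_inj; rewrite /= modn_small. Qed.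

Lemma vtx_eq i j : (vtx i == vtx j) = (i == j %[mod n.+3]).
Proof. by []. Qed.

Lemma vtx_shift_neq i k : 0 < k < n.+3 -> (vtx (i + k) == vtx i) = false.
Proof.
move=> /andP[k0 kn]; rewrite vtx_eq -{2}[i]addn0 eqn_modDl mod0n modn_small //.
by case: k k0 kn.
Qed.

Lemma nbhd_vtx i : nbhd (vtx i.+1) = [set vtx i; vtx i.+2].
Proof.
apply/setP => u; rewrite !inE -[u]vtx_ord; move: (val u) => j {u}.
rewrite /adj /= /cycle_adj vtx_eq /=.
rewrite -[(i.+1 %% _).+1]addn1 modnDml addn1 !modn_mod.
rewrite -[(j %% _).+1]addn1 modnDml -[i.+1]addn1 eqn_modDr addn1 !vtx_eq.
rewrite [(i %% _ == _)]eq_sym; case: (eqVneq (j %% _) (i.+1 %% _)) => [-> | _] /=; last exact: orbC.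
have := vtx_shift_neq i 1 isT; have := vtx_shift_neq i.+1 1 isT.
by rewrite !vtx_eq !addn1 eq_sym => -> ->.
Qed.

Lemma private_left S i :
  (nbhd (vtx i.+1) :&: ~: S == [set vtx i]) = (vtx i \notin S) && (vtx i.+2 \in S).
Proof.
rewrite nbhd_vtx; apply/eqP/andP => [/setP E | [h1 h2]].
  have := E (vtx i); have := E (vtx i.+2).
  rewrite !inE !eqxx orbT /= -[i.+2]addn2 vtx_shift_neq //.
  by move=> /negbFE -> ->.
apply/setP => u; rewrite !inE.
by case: eqP => [->|_] //=; case: eqP => [->|_]; rewrite ?h2.
Qed.

Lemma private_right S i :
  (nbhd (vtx i.+1) :&: ~: S == [set vtx i.+2]) = (vtx i.+2 \notin S) && (vtx i \in S).
Proof.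
rewrite nbhd_vtx; apply/eqP/andP => [/setP E | [h1 h2]].
  have := E (vtx i); have := E (vtx i.+2).
  rewrite !inE !eqxx orbT /= -[i.+2]addn2 [vtx i == _]eq_sym vtx_shift_neq //.
  by move=> -> /negbFE ->.
apply/setP => u; rewrite !inE orbC.
by case: eqP => [->|_] //=; case: eqP => [->|_]; rewrite ?h2.
Qed.

Lemma super_dominating_cycleP S :
  reflect (forall i, supported (vtx i \in S) (vtx i.+1 \in S) (vtx i.+2 \in S)
             (vtx i.+3 \in S) (vtx i.+4 \in S))
          (super_dominating S).
Proof.
apply: (iffP andP) => [[_ /forall_inP sd] i | ok].
  rewrite /supported; case: (boolP (vtx i.+2 \in S)) => //= uS.
  have /exists_inP[v vS /eqP E] : [exists v in S, nbhd v :&: ~: S == [set vtx i.+2]].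
    by apply: sd; rewrite inE.
  have : v \in nbhd (vtx i.+2).
    by rewrite inE adj_sym; have := set11 (vtx i.+2); rewrite -E !inE => /andP[].
  move: E vS; rewrite nbhd_vtx !inE => /eqP E vS /orP[] /eqP vE; subst v.
    by move: E; rewrite private_right vS => /andP[_ ->].
  by move: E; rewrite private_left vS => /andP[_ ->]; rewrite orbT.
have priv u : u \in ~: S -> exists2 v, v \in S & nbhd v :&: ~: S == [set u].
  (* Shifting [u] by one full turn gives it two predecessors without subtraction: the window centred
     at [u] starts at [(u + n).+1]. *)
  rewrite inE -[u]vtx_ord -vtx_periodic !addnS -[_ + n]/(_ + n) => uS.
  have := ok (u + n).+1; rewrite /supported (negPf uS) /=.
  case/orP => /andP[h1 h2].
    by exists (vtx (u + n).+2); rewrite // private_right uS.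
  by exists (vtx (u + n).+4); rewrite // private_left uS.
split; apply/forall_inP => u uS; have [v vS E] := priv u uS; apply/exists_inP; exists v => //.
(* The vertex [v] having [u] as its only neighbour outside [S] is adjacent to [u], which gives
   domination. *)
by rewrite adj_sym; have := set11 u; rewrite -(eqP E) !inE => /andP[].
Qed.

Definition word S : n.+3.-tuple bool := [tuple i \in S | i < n.+3].

Lemma wordE S : word S = mkseq (fun i => vtx i \in S) n.+3 :> seq bool.
Proof.
apply: (@eq_from_nth _ false) => [|i]; rewrite size_tuple ?size_mkseq // => h.
rewrite nth_mkseq // -[i]/(val (Ordinal h)) -tnth_nth tnth_mktuple.
by rewrite vtx_ord.
Qed.

Lemma word_bij : bijective word.
Proof.
exists (fun w : n.+3.-tuple bool => [set i : 'I_n.+3 | tnth w i] : {set G}) => [S|w].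
  by apply/setP => i; rewrite inE tnth_mktuple.
by apply: eq_from_tnth => i; rewrite tnth_mktuple inE.
Qed.

Lemma count_word S : count id (word S) = #|S|.
Proof.
by rewrite count_map cardE size_filter val_ord_tuple -enumT; apply: eq_count.
Qed.

(** A supported word closes up from some live state, and [closed_last4] makes that state unique; an
    unsupported word closes up from none. Writing the indicator as a sum allows summation over sets
    and over states to be exchanged. *)
Lemma super_dominating_sum S :
  super_dominating S = \sum_(s <- live) (run s (word S) == s) :> nat.
Proof.
have x_per i : (vtx (i + n.+3) \in S) = (vtx i \in S) by rewrite vtx_periodic.
pose x i := vtx i \in S.
have -> : \sum_(s <- live) (run s (word S) == s) =
          count (fun s => orbit_at x s n.+3 == s) live.
  by rewrite -sum1_count [RHS]big_mkcond; apply: eq_bigr => s _; rewrite wordE.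
case: super_dominating_cycleP => [ok | nok].
  have [s sl sC] := supported_closed x n.+3 isT x_per ok.
  rewrite (@eq_in_count _ _ (pred1 s)); first by rewrite count_uniq_mem ?sl.
  move=> t tl /=; apply/eqP/eqP => [tC | -> //].
  move: sl tl; rewrite !mem_live => sD tD.
  have last4E := closed_last4 x n.+3 isT x_per.
  exact: etrans (last4E t tD tC) (esym (last4E s sD sC)).
apply/esym/eqP; rewrite -leqn0 leqNgt -has_count; apply/hasP => [[s sl /eqP sC]].
move: sl; rewrite mem_live => sD.
by apply: nok => i; apply: (closed_supported x n.+3 isT x_per s sD sC).
Qed.

Definition sd_count k := #|[set S : {set G} | super_dominating S && (#|S| == k)]|.

Lemma sd_countE k :
  sd_count k = if n.+3 <= 2 * k then closed_walks n.+3 (2 * k - n.+3) else 0.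
Proof.
have -> : sd_count k =
    \sum_(s <- live) #|[set w : n.+3.-tuple bool | (run s w == s) && (count id w == k)]|.
  rewrite /sd_count -sum1dep_card big_mkcond /=.
  transitivity (\sum_(S : {set G}) \sum_(s <- live) ((run s (word S) == s) && (#|S| == k))).
    apply: eq_bigr => S _; case: (#|S| == k); last first.
      by rewrite andbF big1 // => s _; rewrite andbF.
    under eq_bigr do rewrite andbT.
    by rewrite -super_dominating_sum andbT; case: super_dominating.
  rewrite exchange_big; apply: eq_bigr => s _ /=.
  rewrite -sum1dep_card [RHS]big_mkcond (reindex word) /=; last exact: onW_bij word_bij.
  by apply: eq_bigr => S _; rewrite count_word.
case: ifP => nk.
  rewrite /closed_walks; apply: eq_big_seq => s; rewrite mem_live => sD; rewrite -card_walks.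
  apply: eq_card => w; rewrite !inE; case: eqP => //= sC.
  have := closed_balance s w sD sC; rewrite size_tuple.
  by move: (count _ _) (cost _ _); lia.
(* A closed walk cannot have fewer ones than zeros, its cost being a natural number. *)
apply: big1_seq => s /=; rewrite mem_live => sD.
apply/eqP; rewrite cards_eq0; apply/eqP/setP => w; rewrite !inE.
apply/negP => /andP[/eqP sC /eqP wk].
have := closed_balance s w sD sC; rewrite size_tuple wk; lia.
Qed.

(** Sets smaller than [k] have an excess below [c] of the same parity, so the vanishing of those
    counts makes [k] the super domination number. *)
Lemma N_sp_cycle c k : 2 * k = n.+3 + c -> 0 < closed_walks n.+3 c ->
  (forall c', c' < c -> ~~ odd (c - c') -> closed_walks n.+3 c' = 0) ->
  N_sp G = closed_walks n.+3 c.
Proof.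
move=> kE pos small.
have E : sd_count k = closed_walks n.+3 c by rewrite sd_countE kE leq_addr addKn.
suff gk : gamma_sp G = k by rewrite /N_sp gk.
apply/eqP; rewrite eqn_leq; apply/andP; split.
  move: pos; rewrite -E card_gt0 => /set0Pn[S]; rewrite inE => /andP[sd /eqP <-].
  exact: gamma_sp_min.
have [S sd Sk] := gamma_sp_witness G; rewrite -Sk leqNgt; apply/negP => lt.
have : 0 < sd_count #|S| by rewrite card_gt0; apply/set0Pn; exists S; rewrite inE sd /=.
rewrite sd_countE; case: ifP => // h; rewrite small //; lia.
Qed.

End Cycle.

(** * The four residue classes modulo 4 *)

Local Open Scope ring_scope.

Theorem theorem6p5 (n : nat) (hn : (3 <= n)%N) :
  [/\ (n = 0 %[mod 4])%N -> N_sp (cycle_graph n) = 4%N,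
      (n = 1 %[mod 4])%N -> N_sp (cycle_graph n) = (2 * n)%N,
      (n = 2 %[mod 4])%N ->
        (N_sp (cycle_graph n))%:R
          = (5%:R * n%:R ^+ 2 - 10%:R * n%:R) / 8%:R :> rat
    & (n = 3 %[mod 4])%N -> N_sp (cycle_graph n) = n].
Proof.
case: n hn => [|[|[|n]]] // _; split=> nE.
- have E : closed_walks n.+3 0 = 4%N by rewrite closed_walks0 //; case: ifP; lia.
  by rewrite (N_sp_cycle n 0 (n.+3 %/ 2)) ?E //; lia.
- have E : closed_walks n.+3 1 = (2 * n.+3)%N.
    by have -> : n.+3 = (4 * ((n - 2) %/ 4) + 5)%N by [lia]; rewrite closed_walks1_1.
  by rewrite (N_sp_cycle n 1 (n.+4 %/ 2)) ?E //; lia.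
- pose m := ((n - 3) %/ 4)%N; have nm : n.+3 = (4 * m + 6)%N by lia.
  rewrite (N_sp_cycle n 2%N (2 * m + 4)%N).
  + by rewrite nm closed_walks2_2; field.
  + by lia.
  + by rewrite nm closed_walks2_2 !muln_gt0 addn_gt0 orbT.
  (* Excess 1 has the wrong parity, and excess 0 would require an order divisible by 4. *)
  + by case=> [|[|c]] //; rewrite closed_walks0 //; case: ifP; lia.
- have E : closed_walks n.+3 1 = n.+3.
    by have -> : n.+3 = (4 * (n %/ 4) + 3)%N by [lia]; rewrite closed_walks1_3.
  by rewrite (N_sp_cycle n 1 (n.+4 %/ 2)) ?E //; lia.
Qed.
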